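(* Let $E$ be an extremally disconnected compact Hausdorff space, let $p\neq q$ be non-isolated points of $E$, let $\gamma:E\to\dot{E}_\gamma$ be the quotient map identifying just $p$ and $q$, and let $a(\gamma)$ be the associated covering operator. (i) $\mathcal{S}(E,a(\gamma))=\{\dot{E}_\gamma,E\}$, which has minimum $\dot{E}_\gamma$. (ii) If $Y$ is a compact Hausdorff space with $Y\neq E$ and $Y\neq\dot{E}_\gamma$, then $\mathcal{S}(Y,a(\gamma))=\{Y\}$, which has minimum $Y$.
   Context: For compact Hausdorff spaces $X,Y$, a continuous surjection $f:Y\to X$ is a covering map if $f(F)\neq X$ for every proper closed $F\subset Y$; then $(Y,f)$ is a cover of $X$. Here $=$ and $\neq$ between spaces mean homeomorphic and not homeomorphic, i.e. homeomorphic spaces are identified. $\dot{E}_\gamma$ is the quotient of $E$ that identifies just $p$ and $q$; $\gamma:E\to\dot{E}_\gamma$ is a covering map. The covering operator $a(\gamma)$ assigns to each compact Hausdorff $Y$ the cover $(a(\gamma)Y,a(\gamma)_Y)$ of $Y$ given by $(E,\gamma)$ if $Y=\dot{E}_\gamma$, and by $(Y,\mathrm{id}_Y)$ if $Y\neq\dot{E}_\gamma$. For a compact Hausdorff space $K$ with $a(\gamma)K=K$, $\mathcal{S}(K,a(\gamma))=\{X : X \text{ compact Hausdorff},\ a(\gamma)X=K\}$, where the space $X$ is identified with the single pair $(X,a(\gamma)_X)$, $a(\gamma)_X:K=a(\gamma)X\to X$ being the covering map assigned by $a(\gamma)$. The order is: $X_1\le X_2$ iff there is a continuous $f:X_2\to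 X_1$ with $a(\gamma)_{X_1}=f\circ a(\gamma)_{X_2}$. *)

(* Defs.v *)
From mathcomp Require Import all_boot generic_quotient.
From mathcomp Require Import all_classical topology.

Set Implicit Arguments.
Unset Strict Implicit.
Unset Printing Implicit Defensive.

Local Open Scope classical_set_scope.
Local Open Scope quotient_scope.

Record compHaus := CompHaus {
  compHaus_sort :> topologicalType;
  compHaus_compact : compact [set: compHaus_sort];
  compHaus_hausdorff : hausdorff_space compHaus_sort }.

Definition extremally_disconnected (T : topologicalType) :=
  forall U : set T, open U -> open (closure U).

Definition homeomorphic (X Y : topologicalType) : Prop :=
  exists (f : X -> Y) (g : Y -> X),
    [/\ continuous f, continuous g, cancel f g & cancel g f].

Definition covering_map (Y X : topologicalType) (f : Y -> X) : Prop :=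
  [/\ continuous f, range f = [set: X]
    & forall F : set Y, closed F -> F <> [set: Y] -> f @` F <> [set: X]].

Record cover_of (X : compHaus) := CoverOf {
  cover_space : compHaus;
  cover_map : cover_space -> X;
  cover_mapP : covering_map cover_map }.

Definition covering_operator := forall X : compHaus, cover_of X.

(* "Homeomorphic spaces are identified": a choice, for all X and Y that are
   homeomorphic, of one homeomorphism X -> Y, such that these homeomorphisms
   compose and the one from X to itself is the identity.  This is the same
   thing as a choice of one space in each homeomorphism class together with
   one homeomorphism from each space to the chosen one in its class; see
   identification_inhabited below. *)
Record identification := Identification {
  ident : forall X Y : compHaus, homeomorphic X Y -> X -> Y;
  ident_continuous : forall (X Y : compHaus) (h : homeomorphic X Y),
    continuous (ident h);
  ident_id : forall (X : compHaus) (h : homeomorphic X X) x, ident h x = x;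
  ident_comp : forall (X Y Z : compHaus) (h : homeomorphic X Y)
    (h' : homeomorphic Y Z) (h'' : homeomorphic X Z) x, ident h' (ident h x) = ident h'' x }.

Lemma homeomorphic_refl (X : topologicalType) : homeomorphic X X.
Proof. by exists id, id; split => // x; exact: cvg_id. Qed.

Lemma homeomorphic_sym (X Y : topologicalType) :
  homeomorphic X Y -> homeomorphic Y X.
Proof. by move=> [f [g [? ? ? ?]]]; exists g, f; split. Qed.

Lemma homeomorphic_trans (X Y Z : topologicalType) :
  homeomorphic X Y -> homeomorphic Y Z -> homeomorphic X Z.
Proof.
move=> [f [g [cf cg fg gf]]] [f' [g' [cf' cg' fg' gf']]].
exists (f' \o f), (g \o g'); split.
- by move=> x; apply: continuous_comp; [exact: cf|exact: cf'].
- by move=> x; apply: continuous_comp; [exact: cg'|exact: cg].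
- by move=> x /=; rewrite fg' fg.
- by move=> x /=; rewrite gf gf'.
Qed.

Section identification_exists.

Let class_of (X : compHaus) : compHaus -> Prop := fun Y => homeomorphic X Y.

Let class_eq (X Y : compHaus) : homeomorphic X Y -> class_of X = class_of Y.
Proof.
move=> h; apply/funext => Z; apply/propext; split.
  exact/homeomorphic_trans/homeomorphic_sym.
exact: homeomorphic_trans.
Qed.

Let some_space : compHaus :=
  @CompHaus bool bool_compact discrete_hausdorff.

Let repr_of (C : compHaus -> Prop) : compHaus :=
  if pselect (exists X, C X) is left h then projT1 (cid h) else some_space.

Let reprP (X : compHaus) : homeomorphic X (repr_of (class_of X)).
Proof.
rewrite /repr_of; case: pselect => [h|[]]; first exact: projT2 (cid h).
by exists X; exact: homeomorphic_refl.
Qed.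

Let to_repr (X : compHaus) : X -> repr_of (class_of X) :=
  projT1 (cid (reprP X)).

Let of_reprP (X : compHaus) := cid (projT2 (cid (reprP X))).

Let of_repr (X : compHaus) : repr_of (class_of X) -> X := projT1 (of_reprP X).

Let cast (C D : compHaus -> Prop) (e : C = D) : repr_of C -> repr_of D :=
  let: erefl := e in id.

Lemma identification_inhabited : inhabited identification.
Proof.
have P X : [/\ continuous (@to_repr X), continuous (@of_repr X),
    cancel (@to_repr X) (@of_repr X) & cancel (@of_repr X) (@to_repr X)].
  exact: projT2 (of_reprP X).
have castc C D (e : C = D) : continuous (cast e).
  by case: _ / e => x; exact: cvg_id.
have cast1 C (e : C = C) x : cast e x = x.
  by rewrite (Prop_irrelevance e erefl).
have castD A B C (e : A = B) (e' : B = C) (e'' : A = C) x :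
    cast e' (cast e x) = cast e'' x.
  by case: _ / e' e'' => e''; rewrite cast1 (Prop_irrelevance e e'').
constructor.
exists (fun X Y h x => @of_repr Y (cast (class_eq h) (@to_repr X x))).
- move=> X Y h x; have [cX _ _ _] := P X; have [_ cY _ _] := P Y.
  apply: (@continuous_comp _ _ _ (cast (class_eq h) \o @to_repr X)).
    by apply: continuous_comp; [exact: cX|exact: castc].
  exact: cY.
- by move=> X h x; rewrite cast1; have [_ _ ->] := P X.
- move=> X Y Z h h' h'' x; have [_ _ _ ->] := P Y.
  by rewrite (castD _ _ _ _ _ (class_eq h'')).
Qed.

End identification_exists.

Section pinch.
Variables (E : compHaus) (p q : E).

Definition pinch_rel : rel E :=
  fun x y => (x == y) || ((x \in [:: p; q]) && (y \in [:: p; q])).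

Lemma pinch_rel_refl : reflexive pinch_rel.
Proof. by move=> x; rewrite /pinch_rel eqxx. Qed.

Lemma pinch_rel_sym : symmetric pinch_rel.
Proof. by move=> x y; rewrite /pinch_rel eq_sym andbC. Qed.

Lemma pinch_rel_trans : transitive pinch_rel.
Proof.
move=> y x z; rewrite /pinch_rel.
case/orP=> [/eqP->//|/andP[xpq ypq]] /orP[/eqP<-|/andP[_ zpq]].
  by rewrite xpq ypq orbT.
by rewrite xpq zpq orbT.
Qed.

Canonical pinch_equiv :=
  EquivRel pinch_rel pinch_rel_refl pinch_rel_sym pinch_rel_trans.

Definition pinch_space : topologicalType :=
  quotient_topology {eq_quot pinch_rel}.

Definition pinch_map : E -> pinch_space :=
  \pi_(quotient_topology {eq_quot pinch_rel}).

Lemma pinch_mapE x y : (pinch_map x = pinch_map y) <-> pinch_rel x y.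
Proof.
by rewrite /pinch_map; split=> [/eqquotP//|h]; apply/eqquotP.
Qed.

Lemma pinch_map_continuous : continuous pinch_map.
Proof. exact: pi_continuous. Qed.

Lemma pinch_map_surj (y : pinch_space) : exists x, pinch_map x = y.
Proof. by exists (repr y); exact: reprK. Qed.

Lemma pinch_space_compact : compact [set: pinch_space].
Proof.
have -> : [set: pinch_space] = pinch_map @` [set: E].
  by apply/seteqP; split=> // y _; have [x <-] := pinch_map_surj y; exists x.
apply: continuous_compact; last exact: compHaus_compact.
exact/continuous_subspaceT/pinch_map_continuous.
Qed.

Lemma pinch_open (A : set E) : open A -> (A p <-> A q) ->
  exists2 B : set pinch_space, open B & forall x, B (pinch_map x) <-> A x.
Proof.
move=> oA Apq.
have AE x y : pinch_rel x y -> A x -> A y.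
  rewrite /pinch_rel !inE => /orP[/eqP->//|].
  by move=> /andP[/orP[]/eqP-> /orP[]/eqP->] //; rewrite Apq.
have BE x : (pinch_map @` A) (pinch_map x) <-> A x.
  by split=> [[y Ay /pinch_mapE yx]|Ax]; [exact: AE Ay|exists x].
exists (pinch_map @` A) => //.
suff: open (pinch_map @^-1` (pinch_map @` A)) by [].
by rewrite (_ : _ @^-1` _ = A)//; apply/seteqP; split=> x /BE.
Qed.

Lemma pinch_space_hausdorff : hausdorff_space pinch_space.
Proof.
have := @compHaus_hausdorff E; rewrite open_hausdorff => hE.
have sep (x y : E) : x <> y -> exists A B : set E,
    [/\ open A, open B, A x, B y & A `&` B = set0].
  move=> /eqP/hE[[A B] /= [/set_mem Ax /set_mem By] [oA oB /eqP AB]].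
  by exists A, B.
have fin (x y : E) : x <> p -> x <> q -> ~~ pinch_rel x y ->
  exists A B : set E, [/\ open A /\ open B, (A p <-> A q) /\ (B p <-> B q),
    A x, B y & A `&` B = set0].
  move=> xp xq xy.
  have [A1 [B1 [oA1 oB1 A1x B1p AB1]]] := sep _ _ xp.
  have [A2 [B2 [oA2 oB2 A2x B2q AB2]]] := sep _ _ xq.
  have xy' : x <> y by move=> xy'; move: xy; rewrite xy' pinch_rel_refl.
  have [A3 [B3 [oA3 oB3 A3x B3y AB3]]] := sep _ _ xy'.
  exists (A1 `&` A2 `&` A3), (B1 `|` B2 `|` B3).
  have d (A B : set E) z : A `&` B = set0 -> A z -> B z -> False.
    by move=> AB Az Bz; have : (A `&` B) z by []; rewrite AB.
  split=> //.
  - split; first by apply: openI => //; exact: openI.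
    by apply: openU => //; exact: openU.
  - split; last by split=> _; left; [right|left].
    by split=> -[[? ?] _]; exfalso; [apply: (d A1 B1 p)|apply: (d A2 B2 q)].
  - by right.
  - rewrite -subset0 => z [[[a1 a2] a3] [[b|b]|b]].
    + exact: (d A1 B1 z).
    + exact: (d A2 B2 z).
    + exact: (d A3 B3 z).
rewrite open_hausdorff => x' y'.
have [x <-] := pinch_map_surj x'; have [y <-] := pinch_map_surj y'.
move=> /eqP xy; have {}xy : ~~ pinch_rel x y.
  by apply/negP => /pinch_mapE.
suff [A [B [[oA oB] [Apq Bpq] Ax By AB]]] : exists A B : set E,
    [/\ open A /\ open B, (A p <-> A q) /\ (B p <-> B q),
    A x, B y & A `&` B = set0].
  have [A' oA' A'E] := pinch_open oA Apq; have [B' oB' B'E] := pinch_open oB Bpq.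
  exists (A', B') => /=; first by split; apply/mem_set; rewrite ?A'E ?B'E.
  split=> //; apply/eqP; rewrite -subset0 => z'.
  have [z <-] := pinch_map_surj z'.
  move=> [/A'E Az /B'E Bz].
  by have : (A `&` B) z by []; rewrite AB.
have [xpq|xpq] := boolP (x \in [:: p; q]); last first.
  move: xpq; rewrite !inE negb_or => /andP[/eqP xp /eqP xq]; exact: fin.
have ypq : y \notin [:: p; q].
  by apply: contra xy => ypq; rewrite /pinch_rel xpq ypq orbT.
move: ypq; rewrite !inE negb_or => /andP[/eqP yp /eqP yq].
have yx : ~~ pinch_rel y x by rewrite pinch_rel_sym.
have [A [B [[oA oB] [Apq Bpq] Ay Bx AB]]] := fin _ _ yp yq yx.
by exists B, A; split=> //; rewrite setIC.
Qed.

Definition pinch : compHaus :=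
  CompHaus pinch_space_compact pinch_space_hausdorff.

Lemma pinch_map_covering :
  ~ isolated [set: E] p -> ~ isolated [set: E] q ->
  covering_map (pinch_map : E -> pinch).
Proof.
move=> ip iq; split; first exact: pinch_map_continuous.
  by apply/seteqP; split=> // y _; have [x <-] := pinch_map_surj y; exists x.
move=> F cF FT FE; apply: FT; apply/seteqP; split=> // x _.
apply: contrapT => nFx.
have Fy z : ~ F z -> z = p \/ z = q.
  move=> nFz; have : (pinch_map @` F) (pinch_map z) by rewrite FE.
  move=> [y Fy /pinch_mapE]; rewrite /pinch_rel !inE.
  case/orP=> [/eqP yz|]; first by rewrite yz in Fy.
  by move=> /andP[_ /orP[]/eqP]; [left|right].
have [y [yFy yNx xy]] : exists y, [/\ F y, y <> x & pinch_rel y x].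
  have : (pinch_map @` F) (pinch_map x) by rewrite FE.
  by move=> [y Fy' /pinch_mapE yx]; exists y; split=> // yx'; rewrite yx' in Fy'.
have Fxx z : ~ F z -> z = x.
  move=> nFz; move: xy; rewrite /pinch_rel !inE.
  case/orP=> [/eqP//|/andP[yy _]].
  have : y <> z by move=> yz; rewrite yz in yFy.
  move: yy (Fy _ nFz) (Fy _ nFx) yNx.
  by case/orP=> /eqP-> [] -> [] ->.
have : isolated [set: E] x.
  split; first exact: mem_set.
  exists (~` F); first by apply: open_nbhs_nbhs; split=> //; exact: closed_openC.
  by rewrite setIT; apply/seteqP; split=> [z /Fxx//|z ->].
by have [->|->] := Fy _ nFx.
Qed.

End pinch.

Lemma id_covering (X : compHaus) : covering_map (@idfun X).
Proof. by split; [move=> x; exact: cvg_id|rewrite image_id|move=> F; rewrite image_id]. Qed.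

Section gluing.
Variables (I : identification) (E : compHaus) (p q : E).
Hypotheses (ip : ~ isolated [set: E] p) (iq : ~ isolated [set: E] q).

Lemma ident_pinch_covering (Y : compHaus) (h : homeomorphic (pinch p q) Y) :
  covering_map (ident I h \o (pinch_map p q : E -> pinch p q)).
Proof.
have [cg sg Fg] := pinch_map_covering ip iq.
have k := homeomorphic_sym h.
have hk y : ident I h (ident I k y) = y.
  by rewrite (ident_comp I k h (homeomorphic_refl Y)) ident_id.
have kh x : ident I k (ident I h x) = x.
  by rewrite (ident_comp I h k (homeomorphic_refl _)) ident_id.
split.
- by move=> x; apply: continuous_comp; [exact: cg|exact: ident_continuous].
- apply/seteqP; split=> // y _.
  have : range (pinch_map p q : E -> pinch p q) (ident I k y) by rewrite sg.
  by move=> [x _ xy]; exists x => //=; rewrite xy hk.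
- move=> F cF /(Fg _ cF) FT FE; apply: FT; apply/seteqP; split=> // x _.
  have [z Fz zx] : ((ident I h \o (pinch_map p q : E -> pinch p q)) @` F)
    (ident I h x) by rewrite FE.
  by exists z => //; rewrite -[LHS]kh -[RHS]kh; congr (ident I k _).
Qed.

(* a(gamma): where Y is identified with the quotient E/{p,q}, its cover is E
   with gamma followed by the identification; this is (E, gamma) itself when Y
   is the quotient, by ident_id. *)
Definition gluing_operator : covering_operator := fun Y =>
  match pselect (homeomorphic (pinch p q) Y) with
  | left h => CoverOf (ident_pinch_covering h)
  | right _ => CoverOf (id_covering Y)
  end.

End gluing.

Section order.
Variables (I : identification) (a : covering_operator) (K : compHaus).

(* The class S(K, a). *)
Definition covered_by (X : compHaus) : Prop :=
  homeomorphic K (cover_space (a X)).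

(* a_X, as a map on K = aX. *)
Definition covered_by_map (X : compHaus) (h : covered_by X) : K -> X :=
  @cover_map _ (a X) \o ident I h.

Definition covered_le (X1 X2 : compHaus) : Prop :=
  exists (h1 : covered_by X1) (h2 : covered_by X2) (f : X2 -> X1),
    continuous f /\ covered_by_map h1 = f \o covered_by_map h2.

Definition is_minimum (X : compHaus) : Prop :=
  covered_by X /\ forall X', covered_by X' -> covered_le X X'.

End order.

(* Main.v *)
Require Import Defs.
From mathcomp Require Import all_boot all_classical topology.

Set Implicit Arguments.
Unset Strict Implicit.
Unset Printing Implicit Defensive.

Local Open Scope classical_set_scope.

(** The covering operator takes only two shapes: on a space homeomorphic to the
    pinched space its cover is [E], and on any other space [X] its cover is [X]
    itself.  Hence a space [X] with cover [K] is either a copy of the pinched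
    space, which forces [K] to be a copy of [E], or a copy of [K]; this
    computes both classes.

    For the minima, every covering map in sight is the quotient map or the
    identity, up to the chosen homeomorphisms.  The quotient map factors
    through each of these, and so the pinched space is below every member of
    the class of [E].  If [Y] is neither [E] nor the pinched space, only
    identities occur and the chosen homeomorphism from [X] to [Y] gives
    [Y <= X].  The required triangles commute exactly, and not merely up to an
    automorphism, because the chosen homeomorphisms compose coherently. *)

Section gluing_cover.
Variables (I : identification) (E : compHaus) (p q : E).
Hypotheses (hp : ~ isolated [set: E] p) (hq : ~ isolated [set: E] q).
Let a := gluing_operator I hp hq.

Lemma gluing_operator_pinch (X : compHaus) (h : homeomorphic (pinch p q) X) :
  a X = CoverOf (ident_pinch_covering I hp hq h).
Proof.
rewrite /a /gluing_operator; case: pselect => // h'.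
by rewrite (Prop_irrelevance h' h).
Qed.

Lemma gluing_operator_id (X : compHaus) :
  ~ homeomorphic (pinch p q) X -> a X = CoverOf (id_covering X).
Proof. by rewrite /a /gluing_operator; case: pselect. Qed.

Lemma covered_by_pinch (K X : compHaus) :
  homeomorphic (pinch p q) X -> covered_by a K X <-> homeomorphic K E.
Proof. by move=> h; rewrite /covered_by (gluing_operator_pinch h). Qed.

Lemma covered_by_id (K X : compHaus) :
  ~ homeomorphic (pinch p q) X -> covered_by a K X <-> homeomorphic K X.
Proof. by move=> h; rewrite /covered_by (gluing_operator_id h). Qed.

End gluing_cover.

(** The order mentions the covers [a X1] and [a X2] inside the types of the
    homeomorphisms from [K], where rewriting is awkward; this form allows them
    to be replaced by known covers. *)
Lemma covered_le_covers (I : identification) (a : covering_operator)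
    (K X1 X2 : compHaus) (c1 : cover_of X1) (c2 : cover_of X2)
    (e1 : a X1 = c1) (e2 : a X2 = c2)
    (h1 : homeomorphic K (cover_space c1))
    (h2 : homeomorphic K (cover_space c2)) (f : X2 -> X1) :
  continuous f ->
  (forall x, cover_map (ident I h1 x) = f (cover_map (ident I h2 x))) ->
  covered_le I a K X1 X2.
Proof.
case: _ / e1 h1 => h1; case: _ / e2 h2 => h2 cf fE.
by exists h1, h2, f; split=> //; apply/funext => x; exact: fE.
Qed.

Lemma identK (I : identification) (X Y : compHaus) (h : homeomorphic X Y)
    (k : homeomorphic Y X) : cancel (ident I h) (ident I k).
Proof. by move=> x; rewrite (ident_comp I h k (homeomorphic_refl X)) ident_id. Qed.

Section gluing_order.
Variables (I : identification) (E : compHaus) (p q : E).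
Hypotheses (hp : ~ isolated [set: E] p) (hq : ~ isolated [set: E] q).
Let a := gluing_operator I hp hq.

(** The factoring map undoes the identification with [X]; when [X] is a copy
    of [E] it is then followed by the quotient map. *)
Lemma pinch_minimum : is_minimum I a E (pinch p q).
Proof.
have hP := homeomorphic_refl (pinch p q); have hE := homeomorphic_refl E.
split=> [|X]; first exact/(covered_by_pinch I hp hq _ hP).
have [h|h] := pselect (homeomorphic (pinch p q) X).
  move=> _; have k := homeomorphic_sym h.
  apply: (@covered_le_covers _ _ _ _ _ _ _
    (gluing_operator_pinch I hp hq hP) (gluing_operator_pinch I hp hq h)
    hE hE (ident I k)).
    exact: ident_continuous.
  by move=> x /=; rewrite ident_id identK.
move=> /(covered_by_id I hp hq _ h) EX; have XE := homeomorphic_sym EX.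
apply: (@covered_le_covers _ _ _ _ _ _ _
  (gluing_operator_pinch I hp hq hP) (gluing_operator_id I hp hq h)
  hE EX ((pinch_map p q : E -> pinch p q) \o ident I XE)).
  move=> x; apply: continuous_comp; first exact: ident_continuous.
  exact: pinch_map_continuous.
by move=> x /=; rewrite !ident_id identK.
Qed.

Lemma covered_by_E (X : compHaus) :
  covered_by a E X <-> homeomorphic X (pinch p q) \/ homeomorphic X E.
Proof.
have [h|h] := pselect (homeomorphic (pinch p q) X).
  split=> _; first by left; exact: homeomorphic_sym.
  exact/(covered_by_pinch I hp hq _ h)/homeomorphic_refl.
split=> [/(covered_by_id I hp hq _ h)/homeomorphic_sym|[]/homeomorphic_sym//].
  by right.
by move=> EX; exact/(covered_by_id I hp hq _ h).
Qed.

Section other_space.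
Variable Y : compHaus.
Hypotheses (YE : ~ homeomorphic Y E) (YP : ~ homeomorphic Y (pinch p q)).

Lemma covered_by_other (X : compHaus) : covered_by a Y X <-> homeomorphic X Y.
Proof.
have [h|h] := pselect (homeomorphic (pinch p q) X).
  split=> [/(covered_by_pinch I hp hq _ h)//|XY]; case: YP.
  exact/homeomorphic_sym/(homeomorphic_trans h).
by split=> [/(covered_by_id I hp hq _ h)|XY];
  [|apply/(covered_by_id I hp hq _ h)]; exact: homeomorphic_sym.
Qed.

Lemma other_minimum : is_minimum I a Y Y.
Proof.
have hY := homeomorphic_refl Y.
split=> [|X /covered_by_other XY]; first exact/covered_by_other.
have nY : ~ homeomorphic (pinch p q) Y by move/homeomorphic_sym.
have nX : ~ homeomorphic (pinch p q) X.
  by move=> PX; apply: nY; exact: homeomorphic_trans PX XY.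
have YX := homeomorphic_sym XY.
apply: (@covered_le_covers _ _ _ _ _ _ _
  (gluing_operator_id I hp hq nY) (gluing_operator_id I hp hq nX)
  hY YX (ident I XY)).
  exact: ident_continuous.
by move=> x /=; rewrite ident_id identK.
Qed.

End other_space.
End gluing_order.

Theorem theorem5p2 (I : identification) (E : compHaus) (p q : E)
    (hE : extremally_disconnected E) (hpq : p <> q)
    (hp : ~ isolated [set: E] p) (hq : ~ isolated [set: E] q) :
  let a := gluing_operator I hp hq in
  ((forall X : compHaus,
      covered_by a E X <-> homeomorphic X (pinch p q) \/ homeomorphic X E) /\
   is_minimum I a E (pinch p q)) /\
  (forall Y : compHaus,
     ~ homeomorphic Y E -> ~ homeomorphic Y (pinch p q) ->
     (forall X : compHaus, covered_by a Y X <-> homeomorphic X Y) /\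
     is_minimum I a Y Y).
Proof.
split; first by split; [exact: covered_by_E|exact: pinch_minimum].
by move=> Y YE YP; split; [exact: covered_by_other|exact: other_minimum].
Qed.
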